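(* Let $q$ be a prime power (odd or even), let $\alpha\in\mathbb{F}_q$ and $\beta,\bar\beta\in\mathbb{F}_{q^2}$ be as in the context, and let $n$ be a positive integer. Then the tangent-Chebyshev rational function satisfies \[ C_n(x,\alpha)=\eta^{-1}\circ x^n\circ\eta \] where $\eta(x):=\rho(1/x)=(\bar\beta x-1)/(\beta x-1)$ and $\eta^{-1}(x)=1/\rho^{-1}(x)=(x-1)/(\beta x-\bar\beta)$. Here $\eta^{-1}\circ\eta=x$, and $\eta$ maps $\mathbb{P}^1(\mathbb{F}_q)$ bijectively onto $\mu_{q+1}$.
   Context: Let $q$ be a prime power and let $h(x)\in\mathbb{F}_q[x]$ be an irreducible polynomial of the form $x^2-\alpha$ if $q$ is odd, and $x^2+x+\alpha$ if $q$ is even. Let $\beta\in\mathbb{F}_{q^2}$ be a root of $h(x)$ and $\bar\beta:=\beta^q$ the other root (so $\bar\beta=-\beta$ if $q$ is odd, $\bar\beta=\beta+1$ if $q$ is even). Set $\rho(x):=(x-\bar\beta)/(x-\beta)$ and $\rho^{-1}(x):=(\beta x-\bar\beta)/(x-1)$, which are inverse under composition. The degree-$n$ Rédei function is $R_n(x,\alpha):=\rho^{-1}\circ x^n\circ\rho\in\mathbb{F}_q(x)$. The degree-$n$ tangent-Chebyshev rational function $C_n(x,\alpha)$ is defined as follows. For odd $q$, \[ C_n(x,\alpha):=\frac{\sum_{i=0}^{\lfloor (n-1)/2\rfloor}\binom{n}{2i+1}\alpha^i x^{2i+1}}{\sum_{i=0}^{\lfloor n/2\rfloor}\binom{n}{2i}\alpha^i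 x^{2i}}. \] For even $q$, $C_n(x,\alpha):=\frac1x\circ R_n(x,\alpha)\circ\frac1x=1/R_n(1/x,\alpha)$. $\mathbb{P}^1(\mathbb{F}_q):=\mathbb{F}_q\cup\{\infty\}$, and $\mu_{q+1}$ is the set of $(q+1)$-th roots of unity in $\mathbb{F}_{q^2}$. *)

(* Defs.v *)
From mathcomp Require Import all_boot all_order all_algebra all_field.

Set Implicit Arguments.
Unset Strict Implicit.
Unset Printing Implicit Defensive.

Import GRing.Theory.
Local Open Scope ring_scope.

Notation ratfun K := {fraction {poly K}}.

Definition rf (K : fieldType) (p : {poly K}) : ratfun K := tofrac p.

Definition rfX (K : fieldType) : ratfun K := rf 'X.

Definition rfC (K : fieldType) (c : K) : ratfun K := rf c%:P.

(* Numerator and denominator of f in lowest terms; they are determined only up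
   to a common nonzero scalar, which affects neither composition nor
   evaluation. *)
Definition rf_num (K : fieldType) (f : ratfun K) : {poly K} :=
  (frac (repr f)).1 %/ gcdp (frac (repr f)).1 (frac (repr f)).2.

Definition rf_den (K : fieldType) (f : ratfun K) : {poly K} :=
  (frac (repr f)).2 %/ gcdp (frac (repr f)).1 (frac (repr f)).2.

(* f o g = f(g(x)), again a rational function. The denominator vanishes only
   if g is constant, equal to a pole of f; the value is then 0 instead of the
   constant oo. *)
Definition rf_comp (K : fieldType) (f g : ratfun K) : ratfun K :=
  (map_poly (@rfC K) (rf_num f)).[g] / (map_poly (@rfC K) (rf_den f)).[g].

Notation "f \oR g" := (rf_comp f g) (at level 50, left associativity).

(* The projective line K u {oo}, with None standing for oo. *)
Definition P1 (K : Type) : Type := option K.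

(* The map P1(K) -> P1(K) induced by f = a / b, with a and b coprime. At oo,
   a`_(size b).-1 is the coefficient of a in degree deg b, so the value is 0
   when deg a < deg b. *)
Definition rf_eval (K : fieldType) (f : ratfun K) (t : P1 K) : P1 K :=
  let a := rf_num f in let b := rf_den f in
  match t with
  | Some c => if b.[c] == 0 then None else Some (a.[c] / b.[c])
  | None => if (size b < size a)%N then None
            else Some (a`_(size b).-1 / lead_coef b)
  end.

Definition hpoly (F : fieldType) (q : nat) (alpha : F) : {poly F} :=
  if odd q then 'X^2 - alpha%:P else 'X^2 + 'X + alpha%:P.

Definition conjq (K : fieldType) (q : nat) (beta : K) : K := beta ^+ q.

Definition rho (K : fieldType) (q : nat) (beta : K) : ratfun K :=
  (rfX K - rfC (conjq q beta)) / (rfX K - rfC beta).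

Definition rho_inv (K : fieldType) (q : nat) (beta : K) : ratfun K :=
  (rfC beta * rfX K - rfC (conjq q beta)) / (rfX K - 1).

(* An element of K(x) for K = F_(q^2); its coefficients lie in F_q. *)
Definition redei (K : fieldType) (q n : nat) (beta : K) : ratfun K :=
  rho_inv q beta \oR (rfX K ^+ n \oR rho q beta).

Definition cheb_odd (K : fieldType) (n : nat) (alpha : K) : ratfun K :=
  rf (\sum_(0 <= i < (n.-1 %/ 2).+1)
        ('C(n, (2 * i).+1)%:R * alpha ^+ i) *: 'X^((2 * i).+1))
  / rf (\sum_(0 <= i < (n %/ 2).+1)
        ('C(n, 2 * i)%:R * alpha ^+ i) *: 'X^(2 * i)).

(* For n > 0. The argument alpha is used for odd q only; for even q it enters
   through its root beta. *)
Definition tangent_chebyshev (K : fieldType) (q n : nat) (alpha beta : K) :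
    ratfun K :=
  if odd q then cheb_odd n alpha
  else (rfX K)^-1 \oR (redei q n beta \oR (rfX K)^-1).

Definition eta (K : fieldType) (q : nat) (beta : K) : ratfun K :=
  rho q beta \oR (rfX K)^-1.

Definition eta_inv (K : fieldType) (q : nat) (beta : K) : ratfun K :=
  (rho_inv q beta)^-1.

(* Main.v *)
(* In even characteristic the identity is formal, as [eta = rho o (1/x)]. In odd
   characteristic [conjq q beta = - beta], and
   [eta^n = ((1 + beta x) / (1 - beta x))^n], whose numerator and denominator
   are [D + beta N] and [D - beta N] for [N / D] the tangent-Chebyshev function;
   [eta^-1] sends this quotient to [N / D]. On points, Frobenius swaps [beta]
   and its conjugate and fixes exactly the image of [F], so it inverts
   [eta (t)] for [t] in [P1 F], and fixes the [eta]-preimage of [z] whenever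
   [z ^ q = z^-1]. *)
From HB Require Import structures.
Require Import Defs.
From mathcomp Require Import all_boot all_order all_algebra all_field.
From mathcomp Require Import generic_quotient ring zify.

Set Implicit Arguments.
Unset Strict Implicit.
Unset Printing Implicit Defensive.

Import GRing.Theory.
Local Open Scope ring_scope.

(** * Fractions of polynomials and their lowest terms *)

Lemma tofrac_repr (R : idomainType) (f : {fraction R}) :
  f = tofrac (frac (repr f)).1 / tofrac (frac (repr f)).2.
Proof.
have d0 : (frac (repr f)).2 != 0 by exact: denom_ratioP.
apply: (canRL (mulfK _)); first by rewrite tofrac_eq0.
rewrite -[f in LHS]reprK; unlock tofrac; rewrite -[LHS]FracField.pi_mul.
apply/eqP; rewrite FracField.equivf_def /FracField.mulf.
by rewrite !numden_Ratio ?mulf_neq0 ?oner_eq0 ?mulr1 // reprK mulrC.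
Qed.

HB.instance Definition _ (K : fieldType) :=
  GRing.RMorphism.copy (@rf K) (@FracField.tofrac {poly K}).

HB.instance Definition _ (K : fieldType) :=
  GRing.RMorphism.copy (@rfC K) (@rf K \o polyC).

Section LowestTerms.
Variable K : fieldType.
Implicit Types (a b p : {poly K}) (f g : ratfun K).

Lemma rf_num_den f : [/\ f = rf (rf_num f) / rf (rf_den f),
  rf_den f != 0 & coprimep (rf_num f) (rf_den f)].
Proof.
have d0 : (frac (repr f)).2 != 0 by exact: denom_ratioP.
rewrite /rf_num /rf_den; set n := (frac (repr f)).1.
set d := (frac (repr f)).2 in d0 *; set c := gcdp n d.
have c0 : c != 0 by rewrite gcdp_eq0 negb_and d0 orbT.
have nE : n = n %/ c * c by rewrite divpK ?dvdp_gcdl.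
have dE : d = d %/ c * c by rewrite divpK ?dvdp_gcdr.
have d0' : d %/ c != 0 by apply: contraNneq d0 => e; rewrite dE e mul0r.
split=> //; last by rewrite coprimep_div_gcd // d0 orbT.
rewrite [LHS]tofrac_repr -/n -/d {1}nE {1}dE /rf !rmorphM /=.
by rewrite -mulf_div divff ?mulr1 // tofrac_eq0.
Qed.

(** Cross-multiplication gives [a * d = n * b] with [n] and [d] coprime, so Gauss's lemma makes [d]
    divide [b], and the cofactor is [c]. *)
Lemma rf_num_den_eq a b : b != 0 ->
  exists2 c, c != 0 &
    a = rf_num (rf a / rf b) * c /\ b = rf_den (rf a / rf b) * c.
Proof.
move=> b0; have [] := rf_num_den (rf a / rf b).
set n := rf_num _; set d := rf_den _ => e d0 cnd.
have ad : a * d = n * b.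
  apply/eqP; rewrite -tofrac_eq !rmorphM /=; apply/eqP.
  by apply/eqP; rewrite -eqr_div ?tofrac_eq0 //; apply/eqP.
have: d %| b.
  by rewrite -(Gauss_dvdpr _ (q := n)) 1?coprimep_sym // -ad dvdp_mull.
case/dvdpP=> c bE; exists c.
  by apply: contraNneq b0 => c0; rewrite bE c0 mul0r.
split; last by rewrite mulrC.
by apply: (mulIf d0); rewrite ad bE mulrA.
Qed.

Definition rf_subst g p : ratfun K := (map_poly (@rfC K) p).[g].

Lemma rf_substC g (c : K) : rf_subst g c%:P = rfC c.
Proof. by rewrite /rf_subst map_polyC hornerC. Qed.

Lemma rf_substX g : rf_subst g 'X = g.
Proof. by rewrite /rf_subst map_polyX hornerX. Qed.

Lemma rf_substB g a b : rf_subst g (a - b) = rf_subst g a - rf_subst g b.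
Proof. by rewrite /rf_subst (rmorphB (map_poly _)) hornerD hornerN. Qed.

Lemma rf_substM g a b : rf_subst g (a * b) = rf_subst g a * rf_subst g b.
Proof. by rewrite /rf_subst (rmorphM (map_poly _)) hornerM. Qed.

Lemma rf_subst1 g : rf_subst g 1 = 1.
Proof. by rewrite rf_substC (rmorph1 (@rfC K)). Qed.

Lemma rf_substXn g p n : rf_subst g (p ^+ n) = rf_subst g p ^+ n.
Proof. by elim: n => [|n IH]; rewrite ?rf_subst1 // !exprS rf_substM IH. Qed.

(** Makes composition computable from any representative: the factor by which [a / b] differs from
    lowest terms cannot vanish at [g], since it divides [b], and so cancels. *)
Lemma rf_compE a b g : rf_subst g b != 0 ->
  rf a / rf b \oR g = rf_subst g a / rf_subst g b.
Proof.
move=> bg; have b0 : b != 0.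
  apply: contraNneq bg => ->; rewrite -[0](subrr (0 : {poly K})) rf_substB.
  by rewrite subrr.
have [c c0 []] := rf_num_den_eq a b0; rewrite /rf_comp.
rewrite -!/(rf_subst g _); move: (rf_num _) (rf_den _) => n d aE bE.
rewrite aE bE !rf_substM -mulf_div divff; first by rewrite mulr1.
by apply: contraNneq bg => cg; rewrite bE rf_substM cg mulr0.
Qed.

(** The common factor divides [gcdp a b], a unit, so it is a constant. *)
Lemma rf_num_den_coprime a b : b != 0 -> coprimep a b ->
  exists2 c, c != 0 &
    a = c *: rf_num (rf a / rf b) /\ b = c *: rf_den (rf a / rf b).
Proof.
move=> b0 cab; have [c c0 []] := rf_num_den_eq a b0.
move: (rf_num _) (rf_den _) => n d aE bE.
have /size_poly1P[k k0 cE] : size c == 1%N.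
  rewrite -dvdp1 -(eqp_dvdr _ (_ : gcdp a b %= 1)) ?gcdp_eqp1 //.
  by rewrite dvdp_gcd aE bE !dvdp_mull.
by exists k => //; rewrite -!mul_polyC -cE mulrC -aE mulrC -bE.
Qed.

Lemma rf_evalE a b (t : P1 K) : b != 0 -> coprimep a b ->
  rf_eval (rf a / rf b) t =
  match t with
  | Some c => if b.[c] == 0 then None else Some (a.[c] / b.[c])
  | None => if (size b < size a)%N then None
            else Some (a`_(size b).-1 / lead_coef b)
  end.
Proof.
move=> b0 cab; have [k k0 []] := rf_num_den_coprime b0 cab; rewrite /rf_eval.
set n := rf_num _; set d := rf_den _ => -> ->.
case: t => [c|].
  by rewrite !hornerZ mulf_eq0 (negbTE k0) -mulf_div divff ?mul1r.
by rewrite !size_scale // coefZ lead_coefZ -mulf_div divff ?mul1r.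
Qed.

End LowestTerms.

(** * Even and odd parts of a binomial expansion *)

Lemma sum_nat_shrink (R : nmodType) (F : nat -> R) m k : (m <= k)%N ->
  (forall i, (m <= i)%N -> F i = 0) ->
  \sum_(0 <= i < k) F i = \sum_(0 <= i < m) F i.
Proof.
move=> mk F0; rewrite (big_cat_nat (n := m)) //= [X in _ + X]big_nat_cond.
by rewrite [X in _ + X]big1 ?addr0 // => i; rewrite andbT => /andP[/F0].
Qed.

Lemma sum_nat_even_odd (R : nmodType) (F : nat -> R) m :
  \sum_(0 <= i < 2 * m) F i
  = \sum_(0 <= i < m) F (2 * i)%N + \sum_(0 <= i < m) F (2 * i).+1.
Proof.
elim: m => [|m IH]; first by rewrite muln0 !big_geq ?addr0.
by rewrite mulnS !addSn add0n !big_nat_recr //= IH addrACA addrA.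
Qed.

Lemma expr1D_even_odd (R : comNzRingType) (y : R) n :
  (1 + y) ^+ n = \sum_(0 <= i < (n %/ 2).+1) y ^+ (2 * i) *+ 'C(n, 2 * i)
    + \sum_(0 <= i < (n.-1 %/ 2).+1) y ^+ (2 * i).+1 *+ 'C(n, (2 * i).+1).
Proof.
(* Both sums are padded to [n.+1] terms, the binomials past [n] being 0; interleaved, they run over
   all indices below [2 * n.+1]. *)
rewrite -(@sum_nat_shrink _ _ (n %/ 2).+1 n.+1).
rewrite -(@sum_nat_shrink _ _ (n.-1 %/ 2).+1 n.+1).
- rewrite -(@sum_nat_even_odd _ (fun i => y ^+ i *+ 'C(n, i))).
  rewrite (@sum_nat_shrink _ _ n.+1) ?leq_pmull //; last first.
    by move=> i ni; rewrite bin_small.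
  rewrite exprDn big_mkord; apply: eq_bigr => i _.
  by rewrite expr1n mul1r.
- by rewrite ltnS (leq_trans (leq_div _ _)) // leq_pred.
- by move=> i; rewrite ltn_divLR // => ni; rewrite bin_small //; lia.
- by rewrite ltnS leq_div.
- by move=> i; rewrite ltn_divLR // => ni; rewrite bin_small // mulnC.
Qed.

(** * Identities in the field of rational functions *)

Section Conjugation.
Variables (K : fieldType) (q : nat) (beta : K).
Implicit Types (c d : K) (g : ratfun K).

Let X := rfX K.
Let B := rfC beta.
Let B' := rfC (conjq q beta).
(** [P] and [Q] are the numerator and denominator of [eta]. *)
Let P := B' * X - 1.
Let Q := B * X - 1.

Lemma rf_eq0 (p : {poly K}) : (rf p == 0) = (p == 0).
Proof. exact: tofrac_eq0. Qed.

Lemma rfX_neq0 : rfX K != 0.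
Proof. by rewrite rf_eq0 polyX_eq0. Qed.

Lemma rf_linE c : rfC c * X - 1 = rf (c%:P * 'X - 1).
Proof. by rewrite (rmorphB (@rf K)) (rmorphM (@rf K)) (rmorph1 (@rf K)). Qed.

Lemma rf_lin_neq0 c : rfC c * X - 1 != 0.
Proof.
rewrite rf_linE rf_eq0; apply/eqP => /(congr1 (horner^~ 0)).
by rewrite !hornerE ?mulr0 ?sub0r => /eqP; rewrite oppr_eq0 oner_eq0.
Qed.

Lemma rfXn_comp n g : rfX K ^+ n \oR g = g ^+ n.
Proof.
have -> : rfX K ^+ n = rf 'X^n / rf 1.
  by rewrite (rmorph1 (@rf K)) divr1 (rmorphXn (@rf K)).
by rewrite rf_compE rf_subst1 ?oner_eq0 // divr1 rf_substXn rf_substX.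
Qed.

Lemma rfXV_comp g : g != 0 -> (rfX K)^-1 \oR g = g^-1.
Proof.
move=> g0; have -> : (rfX K)^-1 = rf 1 / rf 'X.
  by rewrite (rmorph1 (@rf K)) div1r.
by rewrite rf_compE rf_substX // rf_subst1 div1r.
Qed.

Lemma mobius_comp (a b c d : K) g : rfC c * g - rfC d != 0 ->
  (rfC a * X - rfC b) / (rfC c * X - rfC d) \oR g
  = (rfC a * g - rfC b) / (rfC c * g - rfC d).
Proof.
have E s t : rfC s * X - rfC t = rf (s%:P * 'X - t%:P).
  by rewrite (rmorphB (@rf K)) (rmorphM (@rf K)).
by move=> nz; rewrite !E rf_compE !(rf_substB, rf_substM, rf_substC, rf_substX).
Qed.

Lemma etaE : eta q beta = P / Q.
Proof.
have H : forall (F : fieldType) (x b b' : F), x != 0 -> b * x - 1 != 0 ->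
    (x^-1 - b') / (x^-1 - b) = (b' * x - 1) / (b * x - 1).
  move=> F x b b' x0 bx; field; rewrite bx x0 /=.
  by rewrite (_ : 1 + - b * x = - (b * x - 1)) ?oppr_eq0 //; ring.
have := @mobius_comp 1 (conjq q beta) 1 beta X^-1.
rewrite /eta /rho !(rmorph1 (@rfC K)) !mul1r => ->.
  by rewrite (H _ X B B' rfX_neq0 (rf_lin_neq0 beta)).
(* Were [X^-1] the constant [beta], [B * X - 1] would vanish. *)
rewrite subr_eq0; apply/eqP => e; have /eqP[] := rf_lin_neq0 beta.
by rewrite -e mulVf ?subrr // rfX_neq0.
Qed.

Lemma eta_invE : eta_inv q beta = (X - 1) / (B * X - B').
Proof. by rewrite /eta_inv /rho_inv invf_div. Qed.

Hypotheses (beta0 : beta != 0) (beta_neq : conjq q beta != beta).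

(* At [beta^-1] the factor [Q] vanishes and [P] does not. *)
Lemma lincomb_neq0 c d n : c != 0 -> (0 < n)%N ->
  rfC c * P ^+ n - rfC d * Q ^+ n != 0.
Proof.
move=> c0 n0; rewrite /P /Q !rf_linE -!(rmorphXn (@rf K)).
rewrite -!(rmorphM (@rf K)) -(rmorphB (@rf K)) rf_eq0.
apply/eqP => /(congr1 (horner^~ beta^-1)).
rewrite !hornerE divff // subrr expr0n (gtn_eqF n0) mulr0 subr0 => /eqP.
rewrite mulf_eq0 (negbTE c0) expf_eq0 n0 subr_eq0 /= => /eqP e.
by case/eqP: beta_neq; rewrite -[LHS](mulfVK beta0) e mul1r.
Qed.

(** The right-hand side is the normal form to which [redei_conjX] and [cheb_oddE] bring the two
    cases of [tangent_chebyshev]; it arises by clearing [Q ^+ n]. *)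
Lemma eta_inv_comp_pow n : (0 < n)%N ->
  eta_inv q beta \oR (rfX K ^+ n \oR eta q beta)
  = (P ^+ n - Q ^+ n) / (B * P ^+ n - B' * Q ^+ n).
Proof.
move=> n0; rewrite rfXn_comp etaE eta_invE.
have Q0 : Q ^+ n != 0 by rewrite expf_neq0 // rf_lin_neq0.
have D0 : B * P ^+ n - B' * Q ^+ n != 0 by apply: lincomb_neq0.
have H : forall (F : fieldType) (b b' x y : F), y != 0 -> b * x - b' * y != 0 ->
    (x / y - 1) / (b * (x / y) - b') = (x - y) / (b * x - b' * y).
  by move=> F b b' x y y0 xy; field; rewrite xy y0.
have := @mobius_comp 1 1 beta (conjq q beta) ((P / Q) ^+ n).
rewrite !(rmorph1 (@rfC K)) !mul1r => ->; rewrite expr_div_n.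
  exact: (H _ B B' _ _ Q0 D0).
apply: contraNneq D0 => e.
by rewrite -(mulfVK Q0 (P ^+ n)) mulrA -mulrBl e mul0r.
Qed.

(** Substituting [X^-1] turns [X - c] into [- X^-1 * (c * X - 1)], hence [U] and [V] into [P] and
    [Q] up to one common factor, whose [n]-th power [k] cancels. The outer reciprocal then swaps
    numerator and denominator. *)
Lemma redei_conjX n : (0 < n)%N ->
  (rfX K)^-1 \oR (redei q n beta \oR (rfX K)^-1)
  = (P ^+ n - Q ^+ n) / (B * P ^+ n - B' * Q ^+ n).
Proof.
move=> n0; set U : {poly K} := 'X - (conjq q beta)%:P.
set V : {poly K} := 'X - beta%:P.
have rhoE : rho q beta = rf U / rf V by rewrite !(rmorphB (@rf K)).
have V0 : rf V ^+ n != 0 by rewrite expf_neq0 // rf_eq0 polyXsubC_eq0.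
(* At [beta] the factor [V] vanishes and [U] does not. *)
have UV0 : rf U ^+ n - rf V ^+ n != 0.
  rewrite -!(rmorphXn (@rf K)) -(rmorphB (@rf K)) rf_eq0.
  apply/eqP => /(congr1 (horner^~ beta)).
  rewrite !hornerE subrr expr0n (gtn_eqF n0) subr0 => /eqP.
  by rewrite expf_eq0 n0 subr_eq0 eq_sym (negbTE beta_neq).
have redeiE : redei q n beta =
    rf (beta%:P * U ^+ n - (conjq q beta)%:P * V ^+ n) / rf (U ^+ n - V ^+ n).
  clearbody U V; rewrite /redei rfXn_comp rhoE expr_div_n /rho_inv.
  have := @mobius_comp beta (conjq q beta) 1 1 (rf U ^+ n / rf V ^+ n).
  rewrite !(rmorph1 (@rfC K)) !mul1r => ->; last first.
    apply: contraNneq UV0 => e.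
    by rewrite -(mulfVK V0 (rf U ^+ n)) -[X in _ - X]mul1r -mulrBl e mul0r.
  have H : forall (F : fieldType) (b b' x y : F), y != 0 -> x - y != 0 ->
      (b * (x / y) - b') / (x / y - 1) = (b * x - b' * y) / (x - y).
    by move=> F b b' x y y0 xy; field; rewrite xy y0.
  rewrite (H _ B B' _ _ V0 UV0).
  by rewrite 2!(rmorphB (@rf K)) 2!(rmorphM (@rf K)) 2!(rmorphXn (@rf K)).
have X0 : X != 0 := rfX_neq0; set k := (- X^-1) ^+ n.
have k0 : k != 0 by apply: expf_neq0; rewrite oppr_eq0 invr_eq0.
have substE c : rf_subst X^-1 ('X - c%:P) ^+ n = k * (rfC c * X - 1) ^+ n.
  rewrite rf_substB rf_substX rf_substC -exprMn mulrBr mulr1 opprK mulNr.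
  by rewrite mulrCA (mulVf X0) mulr1 addrC.
have PQ0 : P ^+ n - Q ^+ n != 0.
  have := @lincomb_neq0 1 1 n (oner_neq0 _) n0.
  by rewrite !(rmorph1 (@rfC K)) !mul1r.
have D0 : B * P ^+ n - B' * Q ^+ n != 0 by apply: lincomb_neq0.
have compE :
    redei q n beta \oR X^-1 = (B * P ^+ n - B' * Q ^+ n) / (P ^+ n - Q ^+ n).
  have denE : rf_subst X^-1 (U ^+ n - V ^+ n) = k * (P ^+ n - Q ^+ n).
    by rewrite rf_substB !rf_substXn !substE mulrBr.
  have den0 : rf_subst X^-1 (U ^+ n - V ^+ n) != 0.
    by rewrite denE; apply: (mulf_neq0 k0 PQ0).
  have numE : rf_subst X^-1 (beta%:P * U ^+ n - (conjq q beta)%:P * V ^+ n) =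
      k * (B * P ^+ n - B' * Q ^+ n).
    rewrite rf_substB !rf_substM !rf_substXn !substE !rf_substC.
    by rewrite [_ * (k * _)]mulrCA [B' * (k * _)]mulrCA -mulrBr.
  by rewrite redeiE (rf_compE _ den0) numE denE -mulf_div (divff k0) mul1r.
rewrite compE rfXV_comp; first exact: invf_div.
exact: (mulf_neq0 D0 (invr_neq0 PQ0)).
Qed.

(** This is the case [n = 1], where the quotient is [(B' - B) * X] over [B' - B]. *)
Lemma eta_invK : eta_inv q beta \oR eta q beta = rfX K.
Proof.
have D0 := @lincomb_neq0 beta (conjq q beta) 1 beta0 (ltn0Sn 0).
have := eta_inv_comp_pow (ltn0Sn 0); rewrite rfXn_comp !expr1 => ->.
have H : forall (F : fieldType) (b b' x : F),
    b * (b' * x - 1) - b' * (b * x - 1) != 0 ->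
    (b' * x - 1 - (b * x - 1)) / (b * (b' * x - 1) - b' * (b * x - 1)) = x.
  move=> F b b' x nz; apply: (canLR (mulfK nz)); ring.
exact: (H _ B B' X D0).
Qed.

(* The numerator of [cheb_odd], multiplied by [beta], and its denominator are the
   odd and even parts of [(1 + beta * x) ^+ n]. *)
Lemma cheb_oddE alpha n : (0 < n)%N -> 2 != 0 :> K ->
  conjq q beta = - beta -> beta ^+ 2 = alpha ->
  cheb_odd n alpha = (P ^+ n - Q ^+ n) / (B * P ^+ n - B' * Q ^+ n).
Proof.
move=> n0 two0 conjE alphaE.
rewrite /cheb_odd; set O := \sum_(0 <= i < _) _; set E := \sum_(0 <= i < _) _.
(* Stated for any square root [s] of [alpha], so that it applies to both [beta] and [- beta]. *)
have EO (s : K) : s ^+ 2 = alpha -> (1 + s%:P * 'X) ^+ n = E + s%:P * O.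
  move=> sE; rewrite expr1D_even_odd /E /O big_distrr /=.
  congr (_ + _); apply: eq_bigr => i _.
    by rewrite exprMn -rmorphXn /= mul_polyC scalerMnl mulr_natl exprM sE.
  rewrite exprMn -rmorphXn /= !mul_polyC scalerMnl mulr_natl exprS exprM sE.
  by rewrite scalerA mulrnAr.
have PowE (s : K) : s ^+ 2 = alpha ->
    (rfC s * X - 1) ^+ n = (-1) ^+ n * (rf E - rfC s * rf O).
  move=> sE; rewrite rf_linE -(rmorphXn (@rf K)).
  rewrite (_ : s%:P * 'X - 1 = (-1) * (1 + (- s)%:P * 'X)); last first.
    by rewrite polyCN; ring.
  rewrite exprMn EO ?sqrrN // polyCN mulNr (rmorphM (@rf K)) (rmorphXn (@rf K)).
  by rewrite (rmorphN1 (@rf K)) (rmorphB (@rf K)) (rmorphM (@rf K)).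
have := @lincomb_neq0 beta (conjq q beta) n beta0 n0.
rewrite /P /Q /B' conjE !PowE ?sqrrN // (rmorphN (@rfC K)) -/B.
have B0 : B != 0 by rewrite fmorph_eq0.
have R2 : 2 != 0 :> ratfun K by rewrite -(rmorph_nat (@rfC K)) fmorph_eq0.
have k0 : (-1) ^+ n != 0 :> ratfun K by rewrite signr_eq0.
have H : forall (F : fieldType) (k b o e : F),
    k != 0 -> b != 0 -> 2 != 0 :> F ->
    b * (k * (e - - b * o)) - - b * (k * (e - b * o)) != 0 ->
    o / e = (k * (e - - b * o) - k * (e - b * o)) /
      (b * (k * (e - - b * o)) - - b * (k * (e - b * o))).
  move=> F k b o e k0' b0 two.
  (* In this form the nonzero denominator yields [e != 0]; the numerator is [2 * b * k * o]. *)
  have -> : b * (k * (e - - b * o)) - - b * (k * (e - b * o)) = 2 * b * k * e.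
    by ring.
  by rewrite !mulf_eq0 !negb_or => /andP[_ e0]; field; rewrite k0' e0 two b0.
exact: (H _ _ _ _ _ k0 B0 R2).
Qed.

End Conjugation.

(** * Frobenius on the quadratic extension *)

Section FiniteFields.
Variables (q : nat) (F L : finFieldType) (iota : {rmorphism F -> L}).
Hypotheses (hF : #|F| = q) (hL : #|L| = (q ^ 2)%N).

(** [q] is a power of the characteristic of [F], which [iota] carries to [L]; this makes the [q]-th
    power additive on [L]. *)
Lemma card_pchar_nat : [pchar L].-nat q.
Proof.
have [p p_pr pF] := finPcharP F.
rewrite -hF (card_pprimeChar pF : #|F| = _) pnatX.
by rewrite (eq_pnat _ (pcharf_eq (rmorph_pchar iota pF))) pnat_id.
Qed.

Lemma frobB (x y : L) : (x - y) ^+ q = x ^+ q - y ^+ q.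
Proof. by rewrite exprDn_pchar ?exprNn_pchar // card_pchar_nat. Qed.

Lemma frobK (x : L) : (x ^+ q) ^+ q = x.
Proof. by rewrite -exprM mulnn -hL expf_card. Qed.

Lemma frob_iota (a : F) : iota a ^+ q = iota a.
Proof. by rewrite -rmorphXn -{2}(expf_card a) hF. Qed.

(** Over [F] the polynomial [X^q - X] is the product of all [X - a]; mapped to [L] and evaluated at
    [x], it is 0, so some factor vanishes. *)
Lemma frob_fixed (x : L) : x ^+ q = x -> exists a, x = iota a.
Proof.
move=> xq; have /= := congr1 (map_poly iota) (finField_genPoly F).
move/(congr1 (horner^~ x)).
rewrite /= rmorphB /= map_polyXn map_polyX rmorph_prod horner_prod !hornerE.
rewrite hF xq subrr => /esym/eqP/prodf_eq0[a _].
rewrite rmorphB /= map_polyX map_polyC hornerXsubC subr_eq0 => /eqP.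
by exists a.
Qed.

Lemma odd_card_two_neq0 : odd q -> 2 != 0 :> L.
Proof.
move=> oq; apply: contraTneq oq => two0.
have pL : 2%N \in [pchar L] by rewrite !inE two0 eqxx.
have := card_pchar_nat; rewrite (eq_pnat _ (pcharf_eq pL)) => /p_natP[[|k] qE].
  by have := finNzRing_gt1 F; rewrite hF qE.
by rewrite qE oddX.
Qed.

(** * The root [beta] and the values of [eta] on the projective line *)

Variables (alpha : F) (beta : L).
Hypotheses (h_irr : irreducible_poly (hpoly q alpha))
           (h_root : root (map_poly iota (hpoly q alpha)) beta).

Lemma size_hpoly : size (hpoly q alpha) = 3%N.
Proof.
rewrite /hpoly; case: (odd q); first by rewrite size_XnsubC.
by rewrite -addrA size_polyDl size_polyXn // size_XaddC.
Qed.

(** A root in [F] would give a linear factor of an irreducible quadratic. *)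
Lemma beta_notin (a : F) : beta != iota a.
Proof.
apply: contraTneq h_root => ->; rewrite fmorph_root.
apply/negP => ra; have := h_irr.2 ('X - a%:P); rewrite size_XsubC => /(_ isT).
by rewrite dvdp_XsubCl => /(_ ra)/eqp_size; rewrite size_XsubC size_hpoly.
Qed.

Lemma beta_neq0 : beta != 0.
Proof. by rewrite -(rmorph0 iota) beta_notin. Qed.

Lemma beta_mul_neq1 (a : F) : beta * iota a - 1 != 0.
Proof.
rewrite subr_eq0; apply/eqP => e; case/eqP: (beta_notin a^-1); rewrite fmorphV.
have a0 : iota a != 0.
  by apply: contra_eq_neq e => ->; rewrite mulr0 eq_sym oner_neq0.
by apply: (mulIf a0); rewrite e mulVf.
Qed.

Lemma conjq_neq : conjq q beta != beta.
Proof. by apply/eqP => /frob_fixed[a e]; case/eqP: (beta_notin a). Qed.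

Lemma conjq_neq0 : conjq q beta != 0.
Proof. by rewrite expf_neq0 // beta_neq0. Qed.

Lemma odd_sqr : odd q -> beta ^+ 2 = iota alpha.
Proof.
move=> oq; move: h_root; rewrite /hpoly oq rmorphB /= map_polyXn map_polyC.
by rewrite rootE !hornerE subr_eq0 => /eqP.
Qed.

(** Both are square roots of [iota alpha], and [conjq q beta] differs from [beta]. *)
Lemma odd_conjq : odd q -> conjq q beta = - beta.
Proof.
move=> oq; have := odd_sqr oq => e.
have : conjq q beta ^+ 2 == beta ^+ 2.
  by rewrite /conjq -exprM mulnC exprM e frob_iota.
by rewrite eqf_sqr (negbTE conjq_neq) => /eqP.
Qed.

Lemma eta_evalE (t : P1 F) : rf_eval (eta q beta) (omap iota t) =
  Some (if t is Some a then (conjq q beta * iota a - 1) / (beta * iota a - 1)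
        else conjq q beta / beta).
Proof.
have b0 : beta%:P * 'X - 1 != 0 :> {poly L}.
  by rewrite -(rf_eq0 (beta%:P * 'X - 1)) -rf_linE rf_lin_neq0.
have szE (c : L) : c != 0 -> size (c%:P * 'X - 1) = 2%N.
  by move=> c0; rewrite -polyCN size_MXaddC polyC_eq0 (negbTE c0) size_polyC c0.
(* The only zero of the denominator is [beta^-1], where the numerator is
   [conjq q beta / beta - 1]. *)
have cop : coprimep ((conjq q beta)%:P * 'X - 1) (beta%:P * 'X - 1).
  have -> : beta%:P * 'X - 1 = beta *: ('X - beta^-1%:P).
    by rewrite scalerBr -mul_polyC scale_polyC mulfV // beta_neq0.
  rewrite coprimepZr ?beta_neq0 // coprimep_XsubC rootE !hornerE subr_eq0.
  by rewrite (can2_eq (mulfVK beta_neq0) (mulfK beta_neq0)) mul1r conjq_neq.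
rewrite etaE !rf_linE rf_evalE //; case: t => [a|] /=; last first.
  rewrite !szE ?beta_neq0 ?conjq_neq0 // lead_coefE szE ?beta_neq0 //=.
  by rewrite !coefB !coefMX !coefC /= !subr0.
by rewrite !hornerE /= (negbTE (beta_mul_neq1 a)).
Qed.

Lemma eta_eval_inj :
  injective (fun t : P1 F => rf_eval (eta q beta) (omap iota t)).
Proof.
move=> s t; rewrite !eta_evalE => -[].
have D0 (a : F) : beta * iota a - 1 != 0 := beta_mul_neq1 a.
have nz : conjq q beta - beta != 0 by rewrite subr_eq0 conjq_neq.
(* After cross-multiplication the two sides differ, up to sign, by
   [(conjq q beta - beta) * (s - t)], or by [conjq q beta - beta] alone if exactly one point is
   [oo]. *)
case: s t => [s|] [t|] // /eqP; rewrite eqr_div ?beta_neq0 ?D0 //.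
- move=> /eqP e; congr Some; apply: (fmorph_inj iota); apply: (mulfI nz).
  apply/eqP; rewrite -subr_eq0 -oppr_eq0; move/eqP: e.
  by rewrite -subr_eq0; congr (_ == 0); ring.
- move/eqP => e; case/eqP: nz; apply/eqP.
  by move/eqP: e; rewrite -subr_eq0; congr (_ == 0); ring.
- move/eqP => e; case/eqP: nz; apply/eqP; rewrite -oppr_eq0.
  by move/eqP: e; rewrite -subr_eq0; congr (_ == 0); ring.
Qed.

Lemma eta_eval_unity (t : P1 F) : exists2 z : L,
  q.+1.-unity_root z & rf_eval (eta q beta) (omap iota t) = Some z.
Proof.
rewrite eta_evalE; eexists; last by [].
apply/unity_rootP; rewrite exprSr; case: t => [a|].
  rewrite expr_div_n !frobB !exprMn frobK frob_iota expr1n -/(conjq q beta).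
  rewrite mulrA divfK.
    by rewrite divff ?beta_mul_neq1.
  (* [beta * iota a - 1] is the [q]-th power of its conjugate, so the conjugate is nonzero as
     well. *)
  apply: contraNneq (beta_mul_neq1 a) => e.
  rewrite -(frobK beta) -(frob_iota a) -exprMn -(expr1n _ q) -frobB e.
  by rewrite expr0n -hF gtn_eqF // ltnW // finNzRing_gt1.
rewrite expr_div_n frobK -/(conjq q beta) mulrA divfK ?divff ?beta_neq0 //.
exact: conjq_neq0.
Qed.

Lemma unity_eta_eval (z : L) : q.+1.-unity_root z ->
  exists t : P1 F, rf_eval (eta q beta) (omap iota t) = Some z.
Proof.
move/unity_rootP; rewrite exprSr => zq.
have z0 : z != 0.
  by apply: contra_eq_neq zq => ->; rewrite mulr0 eq_sym oner_neq0.
have zV : z ^+ q = z^-1 by rewrite -[RHS]div1r; apply: (canRL (mulfK z0)).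
(* The pole [conjq q beta / beta] of [eta^-1] is the value of [eta] at [oo]. *)
have [e|nz] := eqVneq (beta * z - conjq q beta) 0.
  exists None; rewrite eta_evalE; congr Some; apply: (canLR (mulfK beta_neq0)).
  by rewrite mulrC; apply/esym/eqP; rewrite -subr_eq0 e.
(* The preimage is [eta^-1] at [z]. Frobenius turns it into [(z^-1 - 1) / (conjq q beta * z^-1 -
   beta)], and multiplying both terms by [- z] restores it. *)
have [|a aE] := @frob_fixed ((z - 1) / (beta * z - conjq q beta)).
  rewrite expr_div_n !frobB expr1n exprMn zV /conjq frobK -/(conjq q beta).
  field; rewrite z0 nz /=.
  by rewrite (_ : _ + _ = - (beta * z - conjq q beta)) ?oppr_eq0 //; ring.
exists (Some a); rewrite eta_evalE -aE; congr Some.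
have bb : conjq q beta - beta != 0 by rewrite subr_eq0 conjq_neq.
(* With [a] substituted, [beta * a - 1] has numerator [conjq q beta - beta]. *)
by field; rewrite nz /= (_ : _ + _ = conjq q beta - beta) //; ring.
Qed.

End FiniteFields.

Theorem corollary3p3
  (q : nat) (F L : finFieldType) (iota : {rmorphism F -> L})
  (hF : #|F| = q) (hL : #|L| = (q ^ 2)%N)
  (alpha : F) (h_irr : irreducible_poly (hpoly q alpha))
  (beta : L) (h_root : root (map_poly iota (hpoly q alpha)) beta)
  (n : nat) (hn : (0 < n)%N) :
  tangent_chebyshev q n (iota alpha) beta
    = eta_inv q beta \oR (rfX L ^+ n \oR eta q beta)
  /\ eta q beta
    = (rfC (conjq q beta) * rfX L - 1) / (rfC beta * rfX L - 1)
  /\ eta_inv q beta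
    = (rfX L - 1) / (rfC beta * rfX L - rfC (conjq q beta))
  /\ eta_inv q beta \oR eta q beta = rfX L
  /\ injective (fun t : P1 F => rf_eval (eta q beta) (omap iota t))
  /\ (forall y : P1 L,
        (exists t : P1 F, rf_eval (eta q beta) (omap iota t) = y)
        <-> (exists z : L, (q.+1).-unity_root z /\ y = Some z)).
Proof.
have beta0 := beta_neq0 h_irr h_root.
have beta_neq := conjq_neq hF h_irr h_root.
split.
  rewrite /tangent_chebyshev eta_inv_comp_pow //; case: ifP => oq.
    apply: cheb_oddE => //; first exact: (odd_card_two_neq0 iota hF oq).
      exact: (odd_conjq hF h_irr h_root oq).
    exact: (odd_sqr h_root oq).
  exact: redei_conjX.
split; first exact: etaE.
split; first exact: eta_invE.
split; first exact: eta_invK.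
split; first exact: (eta_eval_inj hF h_irr h_root).
move=> y; split=> [[t <-]|[z [z1 ->]]].
  by have [z z1 ->] := eta_eval_unity hF hL h_irr h_root t; exists z.
exact: (unity_eta_eval hF hL h_irr h_root z1).
Qed.
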